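(* Let $\mathbf{X}\in\mathbb{R}^{n\times p}$, $\beta^*\in\mathbb{R}^p$, $\varepsilon\in\mathbb{R}^n$ and $y=\mathbf{X}\beta^*+\varepsilon$. Let $h:\mathbb{R}^p\to[0,+\infty]$ be any function (not necessarily convex) and assume that there exists a solution $\hat\beta$ to the minimization problem $$\hat\beta\in\operatorname*{argmin}_{\beta\in\mathbb{R}^p}\ \|\mathbf{X}\beta-y\|^2+2h(\beta).$$ Then for all $t\ge 0$ we have $$F\big(\|\mathbf{X}(\hat\beta-\beta^* )\|\big)\ \ge\ F(t),$$ that is, the prediction error $\|\mathbf{X}(\hat\beta-\beta^* )\|$ is a maximizer of the function $F$, for every value of the noise vector $\varepsilon\in\mathbb{R}^n$.
   Context: $\|\cdot\|$ is the Euclidean norm. The function $F:\mathbb{R}\to[-\infty,+\infty)$ (which depends on $\varepsilon$) is defined by $$F(t)=\sup_{\beta\in\mathbb{R}^p:\ \|\mathbf{X}(\beta-\beta^* )\|\le t}\big(\varepsilon^T\mathbf{X}(\beta-\beta^* )-h(\beta)\big)-t^2/2,$$ with the convention that the supremum over an empty set is $-\infty$. *)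

(* Defs.v *)
From HB Require Import structures.
From mathcomp Require Export all_boot all_order all_algebra.
From mathcomp Require Export classical_sets reals ereal.

Set Implicit Arguments.
Unset Strict Implicit.
Unset Printing Implicit Defensive.

Local Open Scope classical_set_scope.
Local Open Scope ring_scope.
Local Open Scope ereal_scope.

(* The norm that MathComp-Analysis puts on matrices is the sup norm, hence the
   separate Euclidean norm. *)
Definition enorm (R : realType) (n : nat) (v : 'cV[R]_n) : R :=
  Num.sqrt (\sum_(i < n) (v i 0) ^+ 2)%R.

Definition is_argmin (R : realType) (T : Type) (f : T -> \bar R) (x : T) : Prop :=
  forall z : T, f x <= f z.

Definition is_maximizer (R : realType) (T : Type) (f : T -> \bar R) (x : T) : Prop :=
  forall z : T, f z <= f x.

Definition objective (R : realType) (n p : nat) (X : 'M[R]_(n, p)) (y : 'cV[R]_n)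
    (h : 'cV[R]_p -> \bar R) (beta : 'cV[R]_p) : \bar R :=
  ((enorm (X *m beta - y)) ^+ 2)%:E + 2%:E * h beta.

(* [ereal_sup set0 = -oo], and [-oo - r%:E = -oo], so this is -oo whenever the
   constraint set is empty, in particular for t < 0. *)
Definition F (R : realType) (n p : nat) (X : 'M[R]_(n, p)) (betas : 'cV[R]_p)
    (eps : 'cV[R]_n) (h : 'cV[R]_p -> \bar R) (t : R) : \bar R :=
  ereal_sup [set ((eps^T *m (X *m (beta - betas))) 0 0)%:E - h beta
            | beta in [set beta | (enorm (X *m (beta - betas)) <= t)%R]]
  - (t ^+ 2 / 2)%:E.

(* Main.v *)
Require Import Defs.
From mathcomp Require Import ring lra.

(** Put u(beta) = X(beta - betas). Expanding the square in the objective gives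
    ||X beta - y||^2 + 2 h(beta)
      = ||eps||^2 - 2 (<eps, u(beta)> - h(beta) - ||u(beta)||^2 / 2),
    so betahat maximizes <eps, u> - h - ||u||^2 / 2. If ||u(beta)|| <= t, then
    replacing ||u(beta)||^2 by t^2 only decreases this quantity, hence F t is
    at most its value at betahat, which is in turn at most F ||u(betahat)||. *)

Set Implicit Arguments.
Unset Strict Implicit.
Unset Printing Implicit Defensive.

Import Order.TTheory GRing.Theory Num.Theory.

Local Open Scope classical_set_scope.
Local Open Scope ring_scope.
Local Open Scope ereal_scope.

Lemma enorm_ge0 (R : realType) (n : nat) (v : 'cV[R]_n) : (0 <= enorm v)%R.
Proof. exact: sqrtr_ge0. Qed.

Lemma sqr_enorm (R : realType) (n : nat) (v : 'cV[R]_n) :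
  (enorm v ^+ 2 = \sum_(i < n) v i 0 ^+ 2)%R.
Proof. by rewrite sqr_sqrtr // sumr_ge0 // => i _; rewrite sqr_ge0. Qed.

(** Written as [v^T *m u], the inner product at [v := eps] is literally the noise term of [F]. *)
Lemma sqr_enormB (R : realType) (n : nat) (u v : 'cV[R]_n) :
  (enorm (u - v) ^+ 2 = enorm u ^+ 2 - 2 * (v^T *m u) 0 0 + enorm v ^+ 2)%R.
Proof.
rewrite !sqr_enorm mxE mulr_sumr -sumrB -big_split /=.
by apply: eq_bigr => i _; rewrite !mxE; ring.
Qed.

Lemma argmin_objective_penalized (R : realType) (n p : nat) (X : 'M[R]_(n, p))
    (betas : 'cV[R]_p) (eps : 'cV[R]_n) (h : 'cV[R]_p -> \bar R)
    (h_ge0 : forall beta, 0 <= h beta) (betahat : 'cV[R]_p) :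
  is_argmin (objective X (X *m betas + eps)%R h) betahat ->
  is_maximizer (fun b => ((eps^T *m (X *m (b - betas))) 0 0)%:E - h b
                         - (enorm (X *m (b - betas)) ^+ 2 / 2)%:E) betahat.
Proof.
move=> hmin beta; move: (hmin beta).
rewrite /objective !opprD !addrA -!mulmxBr !sqr_enormB.
move: (h_ge0 beta) (h_ge0 betahat).
(* Nonnegativity excludes [-oo]. If only [h betahat] is [+oo], minimality fails against [beta]; if
   only [h beta] is, the value at [beta] is [-oo]. *)
case: (h beta) => [a| |] //; case: (h betahat) => [b| |] // _ _.
- by rewrite -!EFinM -!EFinD !lee_fin; lra.
- by rewrite gt0_muley ?lte_fin // addey // -EFinM -EFinD leye_eq.
- by move=> _; exact: leNye.
Qed.

Lemma F_le_argmin (R : realType) (n p : nat) (X : 'M[R]_(n, p))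
    (betas : 'cV[R]_p) (eps : 'cV[R]_n) (h : 'cV[R]_p -> \bar R)
    (h_ge0 : forall beta, 0 <= h beta) (betahat : 'cV[R]_p) (t : R) :
  is_argmin (objective X (X *m betas + eps)%R h) betahat ->
  F X betas eps h t <= F X betas eps h (enorm (X *m (betahat - betas))).
Proof.
move=> hmin; rewrite {1}/F leeBlDr //.
apply: ge_ereal_sup => _ [beta /= beta_t <-]; rewrite -leeBlDr //.
have t2_ge : (enorm (X *m (beta - betas)) ^+ 2 <= t ^+ 2)%R.
  (* A feasible [beta] forces [0 <= t], so squaring preserves the order; for negative [t] no [beta]
     is feasible. *)
  by rewrite ler_sqr ?nnegrE ?enorm_ge0 // (le_trans _ beta_t) ?enorm_ge0.
apply: (@le_trans _ _ (((eps^T *m (X *m (beta - betas))) 0 0)%:E - h beta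
    - (enorm (X *m (beta - betas)) ^+ 2 / 2)%:E)).
  by apply: leeB => //; rewrite lee_fin; lra.
apply: (le_trans (argmin_objective_penalized h_ge0 hmin beta)).
(* [betahat] meets with equality the constraint whose radius is its own prediction error. *)
by apply: leeB => //; apply: ereal_sup_ubound; exists betahat => /=.
Qed.

Theorem proposition2p1 (R : realType) (n p : nat) (X : 'M[R]_(n, p))
    (betas : 'cV[R]_p) (eps y : 'cV[R]_n) (hy : y = (X *m betas + eps)%R)
    (h : 'cV[R]_p -> \bar R) (h_ge0 : forall beta, 0 <= h beta)
    (betahat : 'cV[R]_p) (hmin : is_argmin (objective X y h) betahat) :
  (forall t : R, (0 <= t)%R ->
     F X betas eps h t <= F X betas eps h (enorm (X *m (betahat - betas)))) /\
  is_maximizer (F X betas eps h) (enorm (X *m (betahat - betas))).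
Proof.
by subst y; split=> [t _|t]; exact: F_le_argmin.
Qed.
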